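(* Let $\vartheta\in(0,1)$, $a,b>0$, and let $N_\lambda^1$ be the non-homogeneous Poisson process with Gompertz rate function $\Lambda(t)=\frac{a}{b}\big(e^{bt}-1\big)$. Let $\mathcal{N}_\lambda^{1-\vartheta,1}(t)=I_t^{1-\vartheta}N_\lambda^1(t)$. Then for $t>0$ $$\mathrm{E}\Big[\frac{d}{dt}\mathcal{N}_\lambda^{1-\vartheta,1}(t)\Big]=a\,b^{\vartheta-1}e^{bt}\Big[1+\frac{\vartheta}{\Gamma(1-\vartheta)}\Gamma(-\vartheta,bt)\Big]-\frac{a\,t^{-\vartheta}}{b\,\Gamma(1-\vartheta)}.$$
   Context: $I_t^{\gamma}f(t)=\frac{1}{\Gamma(\gamma)}\int_0^t(t-s)^{\gamma-1}f(s)\,ds$ for $\gamma>0$; $\frac{d}{dt}\mathcal{N}_\lambda^{1-\vartheta,1}(t)=\frac{d}{dt}I_t^{1-\vartheta}N_\lambda^1(t)$ is the Riemann–Liouville derivative of order $\vartheta$ of $N_\lambda^1$. $N_\lambda^1(t)=N(\Lambda(t))$, where $N$ is the standard Poisson process of unit intensity. $\Gamma(s,x)=\int_x^\infty r^{s-1}e^{-r}\,dr$ is the upper incomplete Gamma function. *)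

(* Defs.v *)
From HB Require Import structures.
From mathcomp Require Import all_boot all_order all_algebra.
From mathcomp Require Import all_classical all_reals all_analysis.

Set Implicit Arguments.
Unset Strict Implicit.
Unset Printing Implicit Defensive.

Import Order.TTheory GRing.Theory Num.Theory.
Import numFieldNormedType.Exports.

Local Open Scope classical_set_scope.
Local Open Scope ring_scope.

(* Meaningful for [0 < x], or for [0 <= x] and [0 < s]; otherwise the integral
   diverges and [Rintegral] returns 0. *)
Definition upper_incomplete_gamma (R : realType) (s x : R) : R :=
  \int[lebesgue_measure]_(r in `]x, +oo[) (r `^ (s - 1) * expR (- r)).

Definition gamma (R : realType) (s : R) : R := upper_incomplete_gamma s 0.

(* Riemann-Liouville fractional integral of order [g]. *)
Definition frac_integral (R : realType) (g : R) (f : R -> R) (t : R) : R :=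
  (gamma g)^-1 *
  \int[lebesgue_measure]_(s in `[0, t]) ((t - s) `^ (g - 1) * f s).

(* The sets [B i] may be taken to be [setT], so that the product rule for
   subfamilies is included. *)
Definition mutually_independent (d d' : measure_display)
    (T : measurableType d) (T' : measurableType d') (R : realType)
    (P : probability T R) (n : nat) (X : 'I_n -> T -> T') : Prop :=
  forall B : 'I_n -> set T', (forall i, measurable (B i)) ->
    P (\bigcap_(i in [set: 'I_n]) (X i @^-1` B i)) =
    (\prod_(i < n) P (X i @^-1` B i))%E.

(* The time index ranges over the nonnegative reals: nothing is required of
   [N s] for [s < 0]. Since paths are nondecreasing, the truncated subtraction
   in the increments is the true one. *)
Record standard_poisson_process (d : measure_display) (T : measurableType d)
    (R : realType) (P : probability T R) (N : R -> T -> nat) : Prop := {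
  poisson_measurable : forall s, 0 <= s -> measurable_fun [set: T] (N s) ;
  poisson_start : forall w, N 0 w = 0%N ;
  poisson_nondecreasing : forall w s t, 0 <= s -> s <= t ->
    (N s w <= N t w)%N ;
  poisson_right_continuous : forall w t, 0 <= t ->
    ((N s w)%:R : R) @[s --> t^'+] --> ((N t w)%:R : R) ;
  poisson_independent_increments : forall (n : nat) (t : nat -> R),
    0 <= t 0%N -> (forall i, t i <= t i.+1) ->
    mutually_independent P
      (fun (i : 'I_n) (w : T) => (N (t i.+1) w - N (t i) w)%N) ;
  poisson_increment_law : forall (s t : R) (k : nat), 0 <= s -> s < t ->
    P [set w | (N t w - N s w)%N = k] = (poisson_pmf (t - s) k)%:E
}.

Definition gompertz (R : realType) (a b t : R) : R :=
  a / b * (expR (b * t) - 1).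

(* Poisson process run with the cumulative rate function [L]. *)
Definition nonhomogeneous_poisson (R : realType) (T : Type) (L : R -> R)
    (N : R -> T -> nat) (t : R) (w : T) : R := (N (L t) w)%:R.

(* Pathwise fractional integral [t |-> I_t^g X(t)] of a process [X]. *)
Definition frac_integral_process (R : realType) (T : Type) (g : R)
    (X : R -> T -> R) (t : R) (w : T) : R :=
  frac_integral g (fun s => X s w) t.

(* Main.v *)
Require Import Defs.
From mathcomp Require Import all_boot all_order all_algebra.
From mathcomp Require Import all_classical all_reals all_analysis.
From mathcomp Require Import measurable_realfun ring lra.

Set Implicit Arguments.
Unset Strict Implicit.
Unset Printing Implicit Defensive.

Import Order.TTheory GRing.Theory Num.Theory.
Import numFieldNormedType.Exports.

Local Open Scope classical_set_scope.
Local Open Scope ring_scope.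

(** The running process is a pure jump process, so its fractional integral can
    be differentiated jump by jump. A path of [N] run with the Gompertz clock
    is, up to any time [t1], a finite sum of unit steps at its jump times
    [tau_k]; a unit step at [tau] has fractional integral proportional to
    [(x - tau)^(1 - theta)] for [x > tau] and [0] before. Hence, as long as no
    jump falls exactly on [t], the derivative at [t] exists and equals
    [Gamma(1 - theta)^-1 * \sum_(tau_k < t) (t - tau_k)^(- theta)], while a jump
    at [t] creates a vertical tangent
    ([is_derive_frac_integral_counting_path],
    [frac_integral_jump_not_derivable]).

    The sum over jump times is turned into an integral of increments with
    [u^(- theta) = \int_(r > u) theta * r^(- theta - 1)] ([powR_layer_cake]):
    taking [u = b (t - tau_k)], the sum becomes, up to the factor [b^theta], the
    integral [weighted_increments] over [r > 0] of [theta * r^(- theta - 1)]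
    against the number of jumps in [(t - r / b, t]]. This integral is [+oo] exactly
    when there is a jump at [t]. It is therefore a measurable extended-real
    functional of the path which detects the exceptional event by itself: once
    its expectation is finite, almost every path has no jump at [t], and the
    derivative is almost surely a constant multiple of it.

    By Tonelli's theorem and the Poisson law of the increments, its expectation
    is [a / b] times the integral of
    [theta * r^(- theta - 1) * (exp (b t) - exp (max (b t - r) 0))]. The value
    of this last integral ([integral_compensated_exp]) follows from
    [Gamma(1 - theta) = \int_(r > 0) theta * r^(- theta - 1) * (1 - exp (- r))]
    ([EFin_gamma]), which is again the layer-cake formula combined with
    Tonelli's theorem. *)

(** * Power integrals *)

(** Exhausting the domain by segments covers, with a single statement, unbounded
    domains and integrands that blow up at either end: on each segment this is the
    usual fundamental theorem, and monotone convergence does the rest. *)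
Lemma ge0_FTC2_bigcup (R : realType) (f F : R -> R) (u v : R^nat) (A : set R)
    (l : R) :
  (forall n, u n < v n) ->
  nondecreasing_seq (fun n => `[u n, v n]%classic) ->
  \bigcup_n `[u n, v n]%classic = A ->
  (forall x, A x -> 0 <= f x) ->
  (forall x, A x -> {for x, continuous f}) ->
  (forall x, A x -> is_derive x 1 F (f x)) ->
  F (v n) - F (u n) @[n --> \oo] --> l ->
  (\int[lebesgue_measure]_(x in A) (f x)%:E = l%:E)%E.
Proof.
move=> uv nd <- f0 cf dF Fl.
have sub n x : `[u n, v n]%classic x -> (\bigcup_n `[u n, v n]%classic) x
    by exists n.
have cfn n : {within `[u n, v n], continuous f}.
  apply: continuous_in_subspaceT => x xn; apply: cf; apply: (sub n).
  exact: set_mem xn.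
have mI n : measurable (`[u n, v n]%classic : set R) by [].
have mf n : measurable_fun (`[u n, v n]%classic : set (measurableTypeR R))
    (EFin \o f).
  by apply/measurable_EFinP; exact: subspace_continuous_measurable_fun.
have f0n n x : `[u n, v n]%classic x -> (0 <= (EFin \o f) x)%E.
  by move=> xn; rewrite lee_fin; apply: f0; apply: (sub n).
have FTC n : (\int[lebesgue_measure]_(x in `[u n, v n]) (EFin \o f) x =
    (F (v n) - F (u n))%:E)%E.
  have cF x : `[u n, v n]%classic x -> {for x, continuous F}.
    move=> xn; apply/differentiable_continuous/derivable1_diffP.
    by have [] := dF _ (sub n x xn).
  have oc x : x \in `]u n, v n[ -> is_derive x 1 F (f x).
    by move=> xn; apply: dF; apply: (sub n); exact: subset_itv_oo_cc xn.
  rewrite (@continuous_FTC2 _ f F (u n) (v n))//.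
  - split=> [x /oc[]//||].
    + by apply: cvg_at_right_filter; apply: cF; rewrite /= in_itv /= lexx ltW.
    + by apply: cvg_at_left_filter; apply: cF; rewrite /= in_itv /= lexx ltW.
  - by move=> x /oc xn; rewrite derive1E derive_val.
have := @ge0_nondecreasing_set_cvg_integral _ (measurableTypeR R) R
  (fun n => `[u n, v n]%classic) (EFin \o f) lebesgue_measure nd mI mf f0n.
under eq_fun do rewrite FTC.
move=> /cvg_lim <- //; apply/cvg_lim => //.
by apply: cvg_EFin; [exact: nearW|].
Qed.

Lemma exists_nat_ge (R : realType) (y : R) : exists n : nat, y <= n.+2%:R.
Proof.
have [y0|y0] := leP y 0; first by exists 0%N; apply: le_trans y0 _; rewrite ler0n.
exists (Num.truncn y); apply/ltW/(lt_trans (truncnS_gt y)).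
by rewrite ltr_nat.
Qed.

Lemma cvg_harmonic_powR (R : realType) (p : R) : 0 < p ->
  (n.+2%:R^-1 : R) `^ p @[n --> \oo] --> (0 : R).
Proof.
move=> p0.
have h : (n.+2%:R^-1 : R) @[n --> \oo] --> (0 : R)^'+.
  apply: (@cvg_trans _ ((n.+2%:R^-1 : R) @[n --> \oo])) => //.
  move=> U; rewrite /at_right /= => -[e /= e0 eU].
  have [N _ HN] : \forall n \near \oo, ball (0 : R) e (n.+2%:R^-1).
    have : (n.+2%:R^-1 : R) @[n --> \oo] --> (0 : R).
      have := @cvg_harmonic R; rewrite -cvg_shiftS; exact.
    by move/cvg_ball; exact.
  exists N => // n Nn; apply: eU; first exact: HN.
  by rewrite invr_gt0 ltr0n.
exact: cvg_comp h (powR_cvg0 p0).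
Qed.

Lemma gt0_continuous_powR (R : realType) (q x : R) : 0 < x ->
  {for x, continuous (fun r : R => r `^ q)}.
Proof.
by move=> x0; apply/differentiable_continuous/derivable1_diffP/derivable_powR;
  rewrite in_itv/= x0.
Qed.

Lemma integral_powR_tail (R : realType) (p u : R) : 0 < p -> 0 < u ->
  (\int[lebesgue_measure]_(r in `[u, +oo[)
    (p * r `^ (- p - 1))%:E = (u `^ (- p))%:E)%E.
Proof.
move=> p0 u0.
apply: (@ge0_FTC2_bigcup _ _ (fun r => - (r `^ (- p))) (fun=> u)
  (fun n => u * n.+2%:R)).
- by move=> n; rewrite ltr_pMr// ltr1n.
- move=> n m nm; rewrite subsetEset; apply: subset_itvl; rewrite bnd_simp.
  by rewrite ler_pM2l// ler_nat !ltnS.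
- apply/seteqP; split=> x /=.
    by case=> n _; rewrite /= !in_itv/= andbT => /andP[].
  rewrite in_itv/= andbT => ux.
  have [n nx] := exists_nat_ge (x / u).
  by exists n => //=; rewrite in_itv/= ux/= mulrC -ler_pdivrMr.
- by move=> x _; rewrite mulr_ge0 ?powR_ge0// ltW.
- move=> x; rewrite /= in_itv/= andbT => ux.
  have x0 : 0 < x by exact: lt_le_trans ux.
  apply: cvgM; first exact: cvg_cst.
  exact: gt0_continuous_powR.
- move=> x; rewrite /= in_itv/= andbT => ux.
  have x0 : 0 < x by exact: lt_le_trans ux.
  have -> : p * x `^ (- p - 1) = - (- p * x `^ (- p - 1)) by ring.
  exact: (is_deriveN (is_derive1_powR (- p) x0)).
- rewrite (_ : (fun n : nat => _) = (fun n : nat => u `^ (- p) - u `^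
    (- p) * (n.+2%:R^-1) `^ p)).
    rewrite -[X in _ --> X]subr0 -[X in _ --> _ - X](mulr0 (u `^ (- p))).
    apply: cvgB; first exact: cvg_cst.
    by apply: cvgM; [exact: cvg_cst|exact: cvg_harmonic_powR].
  apply/funext => n; rewrite opprK addrC; congr (_ - _).
  rewrite powRM ?(ltW u0)//; congr (_ * _).
  by rewrite -powR_inv1// -powRrM mulN1r.
Qed.

Lemma integral_powR_head (R : realType) (p : R) : 0 < p ->
  (\int[lebesgue_measure]_(r in `]0%R, 1%R]) (r `^ (p - 1))%:E = (p^-1)%:E)%E.
Proof.
move=> p0.
apply: (@ge0_FTC2_bigcup _ _ (fun r => p^-1 * r `^ p) (fun n => n.+2%:R^-1)
  (fun=> 1)).
- by move=> n; rewrite invf_lt1 ?ltr0n// ltr1n.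
- move=> n m nm; rewrite subsetEset; apply: subset_itvr; rewrite bnd_simp.
  by rewrite lef_pV2 ?posrE ?ltr0n// ler_nat !ltnS.
- apply/seteqP; split=> x /=.
    case=> n _; rewrite /= !in_itv/= => /andP[nx ->]; rewrite andbT.
    by apply: lt_le_trans nx; rewrite invr_gt0 ltr0n.
  rewrite in_itv/= => /andP[x0 x1].
  have [n nx] := exists_nat_ge (x^-1).
  by exists n => //=; rewrite in_itv/= x1 andbT -[x]invrK lef_pV2 ?posrE ?ltr0n//
    invr_gt0.
- by move=> x _; rewrite powR_ge0.
- move=> x; rewrite /= in_itv/= => /andP[x0 _].
  exact: gt0_continuous_powR.
- move=> x; rewrite /= in_itv/= => /andP[x0 _].
  have -> : x `^ (p - 1) = p^-1 *: (p * x `^ (p - 1)) by rewrite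
      /GRing.scale/= mulKf// gt_eqF.
  exact: (is_deriveZ p^-1 (is_derive1_powR p x0)).
- rewrite -[X in _ --> X]subr0 -[X in _ --> _ - X](mulr0 p^-1).
  apply: cvgB; first by rewrite powR1 mulr1; exact: cvg_cst.
  by apply: cvgM; [exact: cvg_cst|exact: cvg_harmonic_powR].
Qed.

Lemma integral_powR_right_singular (R : realType) (p tau x : R) : 0 < p ->
    tau < x ->
  (\int[lebesgue_measure]_(s in `[tau, x[) ((x - s) `^ (p - 1))%:E
     = (p^-1 * (x - tau) `^ p)%:E)%E.
Proof.
move=> p0 tx; have xt : 0 < x - tau by rewrite subr_gt0.
have dpow q s : s < x -> is_derive s 1 (fun s => (x - s) `^ q)
    (- (q * (x - s) `^ (q - 1))).
  move=> sx; have xs : 0 < x - s by rewrite subr_gt0.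
  have dB : is_derive s 1 (fun s : R => x - s) (0 - 1).
    exact: (@is_deriveB _ _ _ (cst x) id).
  have := @is_derive1_comp R (fun r : R => r `^ q) (fun s : R => x - s) s _ _
      (is_derive1_powR q xs) dB.
  by rewrite sub0r mulrN1.
apply: (@ge0_FTC2_bigcup _ _ (fun s => - (p^-1 * (x - s) `^ p)) (fun=> tau)
  (fun n => x - (x - tau) * n.+2%:R^-1)).
- move=> n; rewrite ltrBrDr -ltrBrDl gtr_pMr//.
  by rewrite invf_lt1 ?ltr0n// ltr1n.
- move=> n m nm; rewrite subsetEset; apply: subset_itvl; rewrite bnd_simp.
  by rewrite lerB// ler_pM2l// lef_pV2 ?posrE ?ltr0n// ler_nat !ltnS.
- apply/seteqP; split=> s /=.
    case=> n _; rewrite /= !in_itv/= => /andP[-> nx] /=.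
    by apply: le_lt_trans nx _; rewrite gtrBl mulr_gt0// invr_gt0 ltr0n.
  rewrite in_itv/= => /andP[ts sx].
  have [n nx] := exists_nat_ge ((x - tau) / (x - s)).
  exists n => //=; rewrite in_itv/= ts/= lerBrDr -lerBrDl.
  by rewrite ler_pdivrMr ?ltr0n// mulrC -ler_pdivrMr// subr_gt0.
- by move=> s _; rewrite powR_ge0.
- move=> s; rewrite /= in_itv/= => /andP[_ sx].
  by apply/differentiable_continuous/derivable1_diffP; have [] := dpow (p - 1) s sx.
- move=> s; rewrite /= in_itv/= => /andP[_ sx].
  have -> : (x - s) `^ (p - 1) = - (p^-1 *: - (p * (x - s) `^ (p - 1))).
    by rewrite /GRing.scale/= mulrN opprK mulKf// gt_eqF.
  exact: (is_deriveN (is_deriveZ p^-1 (dpow p s sx))).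
- rewrite (_ : (fun n : nat => _) = (fun n : nat => p^-1 * (x - tau) `^ p -
    p^-1 * (x - tau) `^ p * (n.+2%:R^-1) `^ p)).
    rewrite -[X in _ --> X]subr0 -[X in _ --> _ - X](mulr0 (p^-1 * (x - tau) `^ p)).
    apply: cvgB; first exact: cvg_cst.
    by apply: cvgM; [exact: cvg_cst|exact: cvg_harmonic_powR].
  apply/funext => n; rewrite opprK addrC; congr (_ - _).
  by rewrite subKr powRM ?(ltW xt)// mulrA.
Qed.

Lemma measurable_powR_density (R : realType) (p : R) :
  measurable_fun [set: R] (fun r : R => p * r `^ (- p - 1)).
Proof. by apply: measurable_funM => //; exact: measurable_powR. Qed.

(** A power of negative exponent as a superposition of thresholds; this is what
    replaces sums over jump times by counts of jumps. *)
Lemma powR_layer_cake (R : realType) (p u : R) : 0 < p -> 0 < u ->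
  (\int[lebesgue_measure]_(r in `]0%R, +oo[)
    (p * r `^ (- p - 1) * (u < r)%R%:R)%:E =
   (u `^ (- p))%:E)%E.
Proof.
move=> p0 u0; rewrite -integral_powR_tail//.
rewrite -integral_itv_obnd_cbnd; last first.
  apply/measurable_EFinP/measurable_funTS; apply: measurable_funM => //.
rewrite [LHS]integral_mkcond [RHS]integral_mkcond; apply: eq_integral => r _.
rewrite !patchE; have [|ru] := ltP u r.
  move=> ur; rewrite !mem_set ?mulr1//= in_itv/= andbT//.
  exact: lt_trans ur.
rewrite mulr0; case: ifP => _; case: ifPn => //.
all: by rewrite inE/= in_itv/= andbT ltNge ru.
Qed.

(** The threshold formula at [u = 0] has infinite value, by comparison with
    [u = A^(- 1 / p)] for every [A > 0]. This is how a jump at the time of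
    differentiation is detected. *)
Lemma powR_layer_cake0 (R : realType) (p : R) : 0 < p ->
  (\int[lebesgue_measure]_(r in `]0%R, +oo[) (p * r `^ (- p - 1))%:E = +oo)%E.
Proof.
move=> p0; apply/eqyP => A A0.
have mg := measurable_powR_density p.
have g0 r : 0 <= p * r `^ (- p - 1) by rewrite mulr_ge0 ?powR_ge0// ltW.
(* The threshold whose power is A. *)
pose u := A `^ (- p^-1).
have u0 : 0 < u by exact: powR_gt0.
have -> : A = u `^ (- p).
  by rewrite /u -powRrM mulrNN mulVf ?gt_eqF// powRr1// ltW.
rewrite -powR_layer_cake//; apply: ge0_le_integral => //.
- by move=> r _; rewrite lee_fin mulr_ge0.
- apply/measurable_EFinP/measurable_funTS; apply: measurable_funM => //.
  by apply: measurableT_comp => //; exact: measurable_fun_ltr.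
- exact/measurable_EFinP/measurable_funTS.
- by move=> r _; rewrite lee_fin ler_piMr// lern1 leq_b1.
Qed.

(** * Iterated integrals over product sets *)

Lemma tonelli_setX (d1 d2 : measure_display) (T1 : measurableType d1)
    (T2 : measurableType d2) (R : realType)
    (m1 : {sigma_finite_measure set T1 -> \bar R})
    (m2 : {sigma_finite_measure set T2 -> \bar R})
    (A : set T1) (B : set T2) (f : T1 * T2 -> \bar R) :
  measurable A -> measurable B -> measurable_fun [set: T1 * T2] f ->
  (forall z, 0 <= f z)%E ->
  (\int[m1]_(x in A) \int[m2]_(y in B) f (x, y) =
   \int[m2]_(y in B) \int[m1]_(x in A) f (x, y))%E.
Proof.
move=> mA mB mf f0; pose g := f \_ (A `*` B).
have mg : measurable_fun [set: T1 * T2] g.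
  by apply/(measurable_restrictT f); [exact: measurableX|exact: measurable_funTS].
have g0 z : (0 <= g z)%E by rewrite /g patchE; case: ifP.
have := @fubini_tonelli _ _ _ _ _ m1 m2 g mg g0.
have -> : (\int[m1]_x \int[m2]_y g (x, y) = \int[m1]_(x in A) \int[m2]_(y in B) f
    (x, y))%E.
  rewrite [RHS]integral_mkcond; apply: eq_integral => x _; rewrite patchE;
    case: ifPn => xA.
    rewrite [RHS]integral_mkcond; apply: eq_integral => y _.
    by rewrite /g !patchE in_setX xA.
  by apply: integral0_eq => y _; rewrite /g patchE in_setX (negbTE xA).
have -> // : (\int[m2]_y \int[m1]_x g (x, y) = \int[m2]_(y in B)
    \int[m1]_(x in A) f (x, y))%E.
rewrite [RHS]integral_mkcond; apply: eq_integral => y _; rewrite patchE;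
  case: ifPn => yB.
  rewrite [RHS]integral_mkcond; apply: eq_integral => x _.
  by rewrite /g !patchE in_setX yB andbT.
by apply: integral0_eq => x _; rewrite /g patchE in_setX (negbTE yB) andbF.
Qed.

Lemma measurable_integral_setX (d1 d2 : measure_display) (T1 : measurableType d1)
    (T2 : measurableType d2) (R : realType)
    (m2 : {sigma_finite_measure set T2 -> \bar R})
    (B : set T2) (f : T1 * T2 -> \bar R) :
  measurable B -> measurable_fun [set: T1 * T2] f ->
  (forall z, 0 <= f z)%E ->
  measurable_fun [set: T1] (fun x => \int[m2]_(y in B) f (x, y))%E.
Proof.
move=> mB mf f0; pose g := f \_ (setT `*` B).
have mg : measurable_fun [set: T1 * T2] g.
  by apply/(measurable_restrictT f); [exact: measurableX|exact: measurable_funTS].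
have g0 z : (0 <= g z)%E by rewrite /g patchE; case: ifP.
rewrite (_ : (fun x => _) = (fun x => \int[m2]_y g (x, y))%E).
  by apply: (@measurable_fun_fubini_tonelli_F _ _ _ _ _ m2 g).
apply/funext => x; rewrite integral_mkcond; apply: eq_integral => y _.
by rewrite /g !patchE in_setX in_setT.
Qed.

(** * Integral representations of the Gamma functions *)

Lemma measurable_expRN (R : realType) :
  measurable_fun [set: R] (fun r : R => expR (- r)).
Proof. exact: measurableT_comp. Qed.

Lemma measurable_gamma_density (R : realType) (p : R) :
  measurable_fun [set: R] (fun r : R => p * r `^ (- p - 1) * (1 - expR (- r))).
Proof.
apply: measurable_funM; first exact: measurable_powR_density.
by apply: measurable_funB => //; exact: measurable_expRN.
Qed.

Lemma integral_expRN (R : realType) (r : R) : 0 < r ->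
  (\int[lebesgue_measure]_(u in `]0%R, r[) (expR (- u))%:E = (1 - expR (- r))%:E)%E.
Proof.
move=> r0.
have mE := @measurable_expRN R.
have cE : continuous (fun u : R => expR (- u)).
  by move=> u; apply: continuous_comp; [exact: opp_continuous|exact:
    continuous_expR].
rewrite -(@integral_itv_bndoo _ _ _ _ true false);
  last exact/measurable_EFinP/measurable_funTS.
apply: (@ge0_FTC2_bigcup _ _ (fun u => - expR (- u)) (fun=> 0) (fun=> r)) => //.
- by apply/seteqP; split=> x /=; [case|exists 0%N].
- by move=> x _; exact: cE.
- move=> x _; apply: is_derive_eq.
  by rewrite /GRing.scale/=; ring.
- by rewrite oppr0 expR0 opprK addrC; exact: cvg_cst.
Qed.

(** Write [u^(- p)] by thresholds, exchange the integrals, and use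
    [\int_(0 < u < r) exp (- u) = 1 - exp (- r)]. *)
Lemma gamma_layer_cake (R : realType) (p : R) : 0 < p ->
  (\int[lebesgue_measure]_(u in `]0%R, +oo[) (u `^ (- p) * expR (- u))%:E =
   \int[lebesgue_measure]_(r in `]0%R, +oo[)
     (p * r `^ (- p - 1) * (1 - expR (- r)))%:E)%E.
Proof.
move=> p0.
have mpow := measurable_powR_density p.
have mlt r : measurable_fun [set: R] (fun u : R => (u < r)%R%:R : R).
  by apply: measurableT_comp => //; exact: measurable_fun_ltr.
have mlt' u : measurable_fun [set: R] (fun r : R => (u < r)%R%:R : R).
  by apply: measurableT_comp => //; exact: measurable_fun_ltr.
have pow0 r : 0 <= p * r `^ (- p - 1) by rewrite mulr_ge0 ?powR_ge0// ltW.
pose h (z : R * R) := ((expR (- z.1)) * (p * z.2 `^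
  (- p - 1) * (z.1 < z.2)%R%:R))%:E.
transitivity (\int[lebesgue_measure]_(u in `]0%R, +oo[)
  \int[lebesgue_measure]_(r in `]0%R, +oo[) h (u, r))%E.
  apply: eq_integral => u; rewrite inE/= in_itv/= andbT => u0.
  rewrite /h; under eq_integral do rewrite /= EFinM.
  rewrite ge0_integralZl//.
  - by rewrite powR_layer_cake// -EFinM mulrC.
  - apply/measurable_EFinP/measurable_funTS.
    exact: (measurable_funM mpow (mlt' u)).
  - by move=> r _; rewrite lee_fin mulr_ge0.
rewrite (@tonelli_setX _ _ (measurableTypeR R) (measurableTypeR R))//; first last.
- by move=> z; rewrite lee_fin mulr_ge0 ?expR_ge0// mulr_ge0.
- apply/measurable_EFinP; apply: measurable_funM.
    by apply: measurableT_comp => //; exact: measurableT_comp.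
  apply: measurable_funM.
    exact: (measurableT_comp mpow measurable_snd).
  by apply: measurableT_comp => //; exact: measurable_fun_ltr.
apply: eq_integral => r; rewrite inE/= in_itv/= andbT => r0.
rewrite /h; under eq_integral do rewrite /= mulrCA EFinM.
rewrite ge0_integralZl//.
- rewrite [RHS]EFinM; congr (_ * _)%E; rewrite -integral_expRN//.
  rewrite [LHS]integral_mkcond [RHS]integral_mkcond; apply: eq_integral => u _.
  rewrite !patchE; have [ur|ru] := ltP u r.
    by rewrite mulr1; congr (if _ then _ else _); apply/idP/idP;
      rewrite !inE/= !in_itv/= ur !andbT.
  by rewrite mulr0; case: ifP => _; case: ifPn => //;
    rewrite inE/= in_itv/= [u < r]ltNge ru andbF.
- apply/measurable_EFinP/measurable_funTS; apply: measurable_funM; last exact: mlt.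
  exact: measurableT_comp.
- by rewrite lee_fin.
Qed.

(** Near [0] the bound [1 - exp (- r) <= r] leaves the integrable [r^(- p)], and
    away from [0] the bound [1 - exp (- r) <= 1] leaves the integrable tail. *)
Lemma gamma_layer_cake_lty (R : realType) (p : R) : 0 < p -> p < 1 ->
  (\int[lebesgue_measure]_(r in `]0%R, +oo[)
    (p * r `^ (- p - 1) * (1 - expR (- r)))%:E < +oo)%E.
Proof.
move=> p0 p1.
have mpow := measurable_powR_density p.
have mh := measurable_gamma_density p.
have h0 r : 0 <= r -> 0 <= p * r `^ (- p - 1) * (1 - expR (- r)).
  by move=> r0; rewrite mulr_ge0 ?subr_ge0// ?expR_le1 ?oppr_le0// mulr_ge0
    ?powR_ge0// ltW.
have -> : `]0, +oo[%classic = (`]0, 1] `|` `]1, +oo[ : set R)%classic.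
  by rewrite -itv_bndbnd_setU ?bnd_simp.
rewrite ge0_integral_setU//=.
- apply: lte_add_pinfty.
  + apply: (@le_lt_trans _ _ (\int[lebesgue_measure]_(r in `]0%R, 1%R])
      (r `^ ((1 - p) - 1))%:E)%E); last first.
      by rewrite integral_powR_head ?subr_gt0// ltry.
    apply: ge0_le_integral => //.
    * by move=> r; rewrite /= in_itv/= => /andP[r0 _]; rewrite lee_fin h0// ltW.
    * exact/measurable_EFinP/measurable_funTS.
    * apply/measurable_EFinP/measurable_funTS; exact: measurable_powR.
    * move=> r; rewrite /= in_itv/= => /andP[r0 _]; rewrite lee_fin.
      have -> : r `^ (1 - p - 1) = r `^ (- p - 1) * r.
        rewrite -[X in _ * X]powRr1 ?ltW// -powRD;
          last by rewrite (gt_eqF r0) implybT.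
        by congr (_ `^ _); ring.
      apply: ler_pM; rewrite ?subr_ge0//.
      * by rewrite mulr_ge0 ?powR_ge0// ltW.
      * by rewrite expR_le1 oppr_le0 ltW.
      * by rewrite ler_piMl ?powR_ge0// ltW.
      * by have := expR_ge1Dx (- r); lra.
  + apply: (@le_lt_trans _ _ (\int[lebesgue_measure]_(r in `]1%R, +oo[)
      (p * r `^ (- p - 1))%:E)%E); last first.
      rewrite integral_itv_obnd_cbnd; last exact/measurable_EFinP/measurable_funTS.
      by rewrite integral_powR_tail// ltry.
    apply: ge0_le_integral => //.
    * by move=> r; rewrite /= in_itv/= andbT => r1;
        rewrite lee_fin h0// ltW// (lt_trans _ r1).
    * exact/measurable_EFinP/measurable_funTS.
    * exact/measurable_EFinP/measurable_funTS.
    * move=> r _; rewrite lee_fin ler_piMr//.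
      by rewrite mulr_ge0 ?powR_ge0// ltW.
- exact/measurable_EFinP/measurable_funTS.
- move=> r []; rewrite in_itv/=.
    by move=> /andP[r0 _]; rewrite lee_fin h0// ltW.
  by rewrite andbT => r1; rewrite lee_fin h0// ltW// (lt_trans _ r1).
- by rewrite disj_set2E; apply/eqP/seteqP; split=> // r /=;
    rewrite !in_itv/= andbT => -[/andP[_]]; case: ltgtP.
Qed.

Lemma gamma_layer_cake_gt0 (R : realType) (p : R) : 0 < p ->
  (0 < \int[lebesgue_measure]_(r in `]0%R, +oo[)
    (p * r `^ (- p - 1) * (1 - expR (- r)))%:E)%E.
Proof.
move=> p0.
have mpow := measurable_powR_density p.
have mh := measurable_gamma_density p.
have c0 : 0 < 1 - expR (- 1) :> R by rewrite subr_gt0 expR_lt1 oppr_lt0.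
apply: (@lt_le_trans _ _ (\int[lebesgue_measure]_(r in `[1%R, +oo[)
  ((1 - expR (-1)) * (p * r `^ (- p - 1)))%:E)%E).
  under eq_integral do rewrite EFinM.
  rewrite ge0_integralZl//.
  - by rewrite integral_powR_tail// powR1 mule1 lte_fin.
  - exact/measurable_EFinP/measurable_funTS.
  - by move=> r _; rewrite lee_fin mulr_ge0 ?powR_ge0// ltW.
apply: (@le_trans _ _ (\int[lebesgue_measure]_(r in `[1%R, +oo[)
  (p * r `^ (- p - 1) * (1 - expR (- r)))%:E)%E).
  apply: ge0_le_integral => //.
  - by move=> r _; rewrite lee_fin mulr_ge0 ?mulr_ge0 ?powR_ge0// ltW.
  - by apply/measurable_EFinP/measurable_funTS; exact: measurable_funM.
  - exact/measurable_EFinP/measurable_funTS.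
  - move=> r; rewrite /= in_itv/= andbT => r1; rewrite lee_fin mulrC ler_wpM2l//.
      by rewrite mulr_ge0 ?powR_ge0// ltW.
    by rewrite lerB// ler_expR lerN2.
apply: ge0_subset_integral => //.
- exact/measurable_EFinP/measurable_funTS.
- move=> r; rewrite /= in_itv/= andbT => r0; rewrite lee_fin.
  by rewrite mulr_ge0 ?subr_ge0// ?expR_le1 ?oppr_le0 ?mulr_ge0 ?powR_ge0// ltW.
- by move=> r /=; rewrite !in_itv/= !andbT; apply: lt_le_trans.
Qed.

Lemma EFin_gamma (R : realType) (p : R) : 0 < p -> p < 1 ->
  ((gamma (1 - p))%:E =
   \int[lebesgue_measure]_(r in `]0%R, +oo[)
     (p * r `^ (- p - 1) * (1 - expR (- r)))%:E)%E.
Proof.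
move=> p0 p1; rewrite -gamma_layer_cake// /gamma /upper_incomplete_gamma
  /Rintegral fineK.
  by rewrite (_ : 1 - p - 1 = - p)//; ring.
rewrite (_ : 1 - p - 1 = - p); last by ring.
rewrite gamma_layer_cake// ge0_fin_numE; first exact: gamma_layer_cake_lty.
exact/ltW/gamma_layer_cake_gt0.
Qed.

Lemma gamma_gt0 (R : realType) (p : R) : 0 < p -> p < 1 -> 0 < gamma (1 - p).
Proof.
by move=> p0 p1; rewrite -lte_fin EFin_gamma//; exact: gamma_layer_cake_gt0.
Qed.

Lemma EFin_upper_incomplete_gamma (R : realType) (p x : R) : 0 < p -> 0 < x ->
  ((upper_incomplete_gamma (- p) x)%:E =
   \int[lebesgue_measure]_(r in `]x, +oo[) (r `^ (- p - 1) * expR (- r))%:E)%E.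
Proof.
move=> p0 x0; rewrite /upper_incomplete_gamma /Rintegral fineK//.
have mE := @measurable_expRN R.
have mpow := measurable_powR_density p.
rewrite ge0_fin_numE; last first.
  by apply: integral_ge0 => r _; rewrite lee_fin mulr_ge0 ?powR_ge0 ?expR_ge0.
apply: (@le_lt_trans _ _ (p^-1%:E * \int[lebesgue_measure]_(r in `]x, +oo[)
  (p * r `^ (- p - 1))%:E)%E); last first.
  rewrite integral_itv_obnd_cbnd; last exact/measurable_EFinP/measurable_funTS.
  by rewrite integral_powR_tail// -EFinM ltry.
rewrite -ge0_integralZl//.
- apply: ge0_le_integral => //.
  + by move=> r _; rewrite lee_fin mulr_ge0 ?powR_ge0 ?expR_ge0.
  + apply/measurable_EFinP/measurable_funTS; apply: measurable_funM => //.
  + by apply/measurable_EFinP/measurable_funTS; exact: measurable_funM.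
  + move=> r; rewrite /= in_itv/= andbT => xr;
      rewrite -EFinM lee_fin mulKf ?gt_eqF//.
    by rewrite ler_piMr ?powR_ge0// expR_le1 oppr_le0 ltW// (lt_trans x0).
- exact/measurable_EFinP/measurable_funTS.
- by move=> r _; rewrite lee_fin mulr_ge0 ?powR_ge0// ltW.
- by rewrite lee_fin invr_ge0 ltW.
Qed.

(** For [r <= x] the integrand is [exp x] times the one representing
    [Gamma(1 - p)]; for [r > x] it falls short of it by
    [p * r^(- p - 1) * (1 - exp (x - r))]. To stay with nonnegative integrands, the
    equality is proved after adding the threshold integral worth [x^(- p)] to the
    left-hand side. *)
Lemma integral_compensated_exp (R : realType) (p x : R) : 0 < p -> p < 1 -> 0 < x ->
  (\int[lebesgue_measure]_(r in `]0%R, +oo[)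
     (p * r `^ (- p - 1) * (expR x - expR (Num.max (x - r) 0)))%:E =
   (expR x * gamma (1 - p) + p * expR x * upper_incomplete_gamma (- p) x
    - x `^ (- p))%:E)%E.
Proof.
move=> p0 p1 x0.
have mE := @measurable_expRN R.
have mpow := measurable_powR_density p.
have pow0 r : 0 <= p * r `^ (- p - 1) by rewrite mulr_ge0 ?powR_ge0// ltW.
have mlt : measurable_fun [set: R] (fun r : R => (x < r)%R%:R : R).
  by apply: measurableT_comp => //; exact: measurable_fun_ltr.
have mh := measurable_gamma_density p.
have h0 r : 0 <= r -> 0 <= p * r `^ (- p - 1) * (1 - expR (- r)).
  by move=> r0; rewrite mulr_ge0 ?subr_ge0// expR_le1 oppr_le0.
have mI : measurable_fun [set: R]
    (fun r : R => p * r `^ (- p - 1) * (expR x - expR (Num.max (x - r) 0))).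
  apply: measurable_funM => //; apply: measurable_funB => //.
  by apply: measurableT_comp => //; apply: measurable_maxr => //;
    exact: measurable_funB.
have I0 r : 0 <= r -> 0 <= p * r `^ (- p - 1) * (expR x - expR (Num.max (x - r) 0)).
  by move=> r0; rewrite mulr_ge0// subr_ge0 ler_expR ge_max (ltW x0) andbT gerBl.
have tail : (\int[lebesgue_measure]_(r in `]0%R, +oo[)
    (r `^ (- p - 1) * expR (- r) * (x < r)%R%:R)%:E =
    (upper_incomplete_gamma (- p) x)%:E)%E.
  rewrite EFin_upper_incomplete_gamma// [LHS]integral_mkcond [RHS]integral_mkcond.
  apply: eq_integral => r _; rewrite !patchE; have [xr|rx] := ltP x r.
    by rewrite mulr1 !mem_set//= in_itv/= andbT// (lt_trans x0).
  by rewrite mulr0; case: ifP => _; case: ifPn => //;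
    rewrite inE/= in_itv/= ltNge rx.
have mtail : measurable_fun [set: R] (fun r : R => r `^ (- p - 1) * expR
    (- r) * (x < r)%R%:R).
  apply: measurable_funM => //; apply: measurable_funM => //;
    exact: measurable_powR.
have eqI : (\int[lebesgue_measure]_(r in `]0%R, +oo[)
     (p * r `^ (- p - 1) * (expR x - expR (Num.max (x - r) 0)))%:E
   + (x `^ (- p))%:E =
   (expR x * gamma (1 - p) + p * expR x * upper_incomplete_gamma (- p) x)%:E)%E.
  rewrite EFinD !(EFinM (expR x)) (EFinM (p * _)) EFin_gamma// -tail
    -powR_layer_cake//.
  rewrite -ge0_integralD//=; last 4 first.
  - by move=> r; rewrite in_itv/= andbT => r0; rewrite lee_fin I0// ltW.
  - exact/measurable_EFinP/measurable_funTS.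
  - by move=> r _; rewrite lee_fin mulr_ge0.
  - apply/measurable_EFinP/measurable_funTS; exact: measurable_funM.
  rewrite -ge0_integralZl; [|by []|exact/measurable_EFinP/measurable_funTS| |by
    rewrite lee_fin expR_ge0]; last first.
    by move=> r; rewrite /= in_itv/= andbT => r0; rewrite lee_fin h0// ltW.
  rewrite -ge0_integralZl; [|by []|exact/measurable_EFinP/measurable_funTS| |by
    rewrite lee_fin mulr_ge0 ?expR_ge0// ltW]; last first.
    by move=> r _; rewrite lee_fin !mulr_ge0 ?powR_ge0 ?expR_ge0.
  rewrite -ge0_integralD//=; last 4 first.
  - by move=> r; rewrite in_itv/= andbT => r0;
      rewrite -EFinM lee_fin mulr_ge0 ?expR_ge0// h0// ltW.
  - exact/measurable_funeM/measurable_EFinP/measurable_funTS.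
  - by move=> r _; rewrite -EFinM lee_fin !mulr_ge0 ?powR_ge0 ?expR_ge0// ltW.
  - exact/measurable_funeM/measurable_EFinP/measurable_funTS.
  apply: eq_integral => r; rewrite inE/= in_itv/= andbT => r0.
  rewrite -!EFinM -!EFinD; congr (_%:E).
  have [xr|rx] := ltP x r.
    by rewrite (max_idPr _) ?expR0 ?subr_le0 ?ltW// !mulr1; ring.
  by rewrite (max_idPl _) ?subr_ge0// expRD !mulr0; ring.
by rewrite EFinB -eqI addeK.
Qed.

(** * Mean and joint measurability of counting processes *)

Lemma measurable_natr_comp (d : measure_display) (T : measurableType d)
    (R : realType) (X : T -> nat) :
  measurable_fun [set: T] X -> measurable_fun [set: T] (fun w => (X w)%:R : R).
Proof. by move=> mX; exact: measurableT_comp. Qed.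

(** Cutting the space along the values of [X] gives [\sum_k k * pmf l k], and
    [k.+1 * pmf l k.+1 = l * pmf l k]; the masses sum to [1] because the same
    pieces cover the probability space. *)
Lemma poisson_mean (d : measure_display) (T : measurableType d) (R : realType)
    (P : probability T R) (X : T -> nat) (l : R) : 0 < l ->
  measurable_fun [set: T] X ->
  (forall k, P [set w | X w = k] = (poisson_pmf l k)%:E) ->
  (\int[P]_w ((X w)%:R)%:E = l%:E)%E.
Proof.
move=> l0 mX Xk; pose F k := [set w | X w = k].
have mF k : measurable (F k).
  by rewrite -[F k]setTI; exact: (mX measurableT [set k]).
have FT : \bigcup_k F k = [set: T] by apply/seteqP; split=> // w _; exists (X w).
have tF : trivIset [set: nat] F by move=> i j _ _ [w [<- <-]].
have pmf1 : (\sum_(k <oo) (poisson_pmf l k)%:E = 1)%E.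
  rewrite -(probability_setT P) -FT measure_bigcup//.
  rewrite [RHS](@eq_eseriesl _ _ xpredT); last by move=> k; rewrite in_setT.
  by apply: eq_eseriesr => k _; rewrite -Xk.
have pmf0 k : (0 <= (poisson_pmf l k)%:E)%E by rewrite lee_fin poisson_pmf_ge0.
have mXE : measurable_fun [set: T] (fun w => ((X w)%:R : R)%:E).
  exact/measurable_EFinP/measurable_natr_comp.
rewrite -FT ge0_integral_bigcup; [|exact: mF|by rewrite FT|by move=> w _;
  rewrite lee_fin|exact: tF].
transitivity (\sum_(k <oo) (k%:R * poisson_pmf l k)%:E)%E.
  apply: eq_eseriesr => k _.
  transitivity (\int[P]_(w in F k) (cst (k%:R : R)%:E) w)%E.
    by apply: eq_integral => w; rewrite inE => /= ->.
  by rewrite integral_cst// EFinM -Xk.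
(* The term of index 0 vanishes; shifting the others factors l out. *)
rewrite (nneseries_split 0%N 1%N); last first.
  by move=> k _; rewrite lee_fin mulr_ge0// poisson_pmf_ge0.
rewrite big_nat1 mul0r add0e -(nneseries_addn 1%N) /=; last first.
  by move=> k; rewrite lee_fin mulr_ge0// poisson_pmf_ge0.
rewrite -[RHS]mule1 -pmf1 -nneseriesZl//.
apply: eq_eseriesr => k _; rewrite -EFinM /poisson_pmf l0 addn1; congr (_%:E).
by rewrite exprS factS natrM invfM; field;
  rewrite pnatr_eq0 -lt0n fact_gt0 addrC natr1 pnatr_eq0.
Qed.

Lemma measurable_increment (d : measure_display) (T : measurableType d)
    (X Y : T -> nat) : measurable_fun [set: T] X -> measurable_fun [set: T] Y ->
  measurable_fun [set: T] (fun w => Y w - X w)%N.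
Proof.
move=> mX mY _ B _; rewrite setTI.
have mE (Z : T -> nat) : measurable_fun [set: T] Z ->
    forall k, measurable [set w | Z w = k].
  by move=> mZ k; rewrite -[[set _ | _]]setTI; exact: (mZ measurableT [set k]).
rewrite (_ : _ @^-1` B = \bigcup_i \bigcup_(j in [set j | B (i - j)%N])
  ([set w | Y w = i] `&` [set w | X w = j])).
  apply: bigcupT_measurable => i; apply: bigcup_measurable => j _.
  by apply: measurableI; exact: mE.
apply/seteqP; split=> [w Bw|w [i _ [j /= + [Yi Xj]]]]; last by rewrite -Yi -Xj.
by exists (Y w) => //; exists (X w).
Qed.

Lemma poisson_increment_mean (d : measure_display) (T : measurableType d)
    (R : realType) (P : probability T R) (N : R -> T -> nat) (s t : R) :
  standard_poisson_process P N -> 0 <= s -> s <= t ->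
  (\int[P]_w ((N t w - N s w)%N%:R)%:E = (t - s)%:E)%E.
Proof.
move=> hN s0; rewrite le_eqVlt => /predU1P[->|st].
  by rewrite subrr; apply: integral0_eq => w _; rewrite subnn.
apply: poisson_mean; first by rewrite subr_gt0.
  by apply: measurable_increment; apply: (poisson_measurable hN) => //;
    rewrite (le_trans s0)// ltW.
by move=> k; exact: (poisson_increment_law hN).
Qed.

(** By right-continuity and monotonicity, [f s w < k] iff [f q w < k] for some
    rational [q > s], so the sublevel sets are countable unions of rectangles. *)
Lemma measurable_right_continuous_process (d : measure_display)
    (T : measurableType d)
    (R : realType) (f : R -> T -> nat) :
  (forall s, measurable_fun [set: T] (f s)) ->
  (forall w s t, s <= t -> (f s w <= f t w)%N) ->
  (forall w t, \forall s \near t^'+, f s w = f t w) ->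
  measurable_fun [set: T * R] (fun z : T * R => f z.2 z.1).
Proof.
move=> mf nd rc.
have mlt k : measurable [set z : T * R | (f z.2 z.1 < k)%N].
  rewrite (_ : [set _ | _] = \bigcup_(q in [set: rat])
    ([set w | (f (ratr q) w < k)%N] `*` `]-oo, (ratr q : R)[%classic)).
    apply: bigcupT_measurable_rat => q; apply: measurableX => //.
    by rewrite -[[set _ | _]]setTI; exact: (mf (ratr q) measurableT [set
      n | (n < k)%N]).
  apply/seteqP; split=> [[w s]/= fk|[w s] [q _ [/= fk]]]; last first.
    rewrite in_itv/= => /ltW sq.
    exact: leq_ltn_trans (nd w _ _ sq) fk.
  have [e /= e0 he] := rc w s.
  have /rat_in_itvoo[q] : s < s + e by rewrite ltrDl.
  rewrite in_itv/= => /andP[sq qe]; exists q => //; split; rewrite /= ?in_itv//=.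
  suff -> : f (ratr q) w = f s w by [].
  apply: he => //=; rewrite /ball/= ltr0_norm ?subr_lt0// opprB.
  by rewrite ltrBlDl.
move=> _ B _; rewrite setTI.
rewrite (_ : _ @^-1` B = \bigcup_(k in B)
    ([set z : T * R | (f z.2 z.1 < k.+1)%N] `\` [set z :
      T * R | (f z.2 z.1 < k)%N])).
  by apply: bigcup_measurable => k _; apply: measurableD; exact: mlt.
apply/seteqP; split=> [z Bz|z [k Bk /= []]].
  by exists (f z.2 z.1) => //=; split; rewrite /= ?ltnn.
rewrite ltnS => h1 /negP; rewrite -leqNgt => h2.
by have -> : f z.2 z.1 = k by apply/eqP; rewrite eqn_leq h1.
Qed.

Lemma cvg_natr_near_eq (U : Type) (F : set_system U) {FF : Filter F}
    (R : realType) (f : U -> nat) (n : nat) :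
  (f x)%:R @[x --> F] --> (n%:R : R) -> \forall x \near F, f x = n.
Proof.
move=> /cvgrPdist_lt/(_ 1 ltr01); apply: filterS => x.
have [fn|fn|//] := ltngtP (f x) n.
  rewrite ger0_norm ?subr_ge0 ?ler_nat 1?ltnW// -natrB 1?ltnW// ltrn1.
  by rewrite ltnS leqn0 subn_eq0 leqNgt fn.
rewrite ler0_norm ?subr_le0 ?ler_nat 1?ltnW// opprB -natrB 1?ltnW// ltrn1.
by rewrite ltnS leqn0 subn_eq0 leqNgt fn.
Qed.

(** * Fractional integrals of counting paths *)

Definition jump_time (R : realType) (f : R -> nat) (k : nat) : R :=
  inf [set s | (k < f s)%N].

(** The paths of a counting process, extended by [0] to negative times, so that
    increments over windows reaching below [0] need no case distinction. *)
Record counting_path (R : realType) (f : R -> nat) : Prop := {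
  counting_path_nd : forall s t, s <= t -> (f s <= f t)%N ;
  counting_path_rc : forall t, \forall s \near t^'+, f s = f t ;
  counting_path_start : f 0 = 0%N
}.

Section counting_path.
Variables (R : realType) (f : R -> nat).
Hypothesis f_path : counting_path f.
Let f_nd := counting_path_nd f_path.
Let f_rc := counting_path_rc f_path.
Let f0 := counting_path_start f_path.

(** Right-continuity makes the infimum a minimum. The count must exceed [k] at some
    time [t1], otherwise the set is empty and [inf] is a default value. *)
Lemma le_jump_time (t1 : R) (k : nat) (s : R) : (k < f t1)%N ->
  (jump_time f k <= s) = (k < f s)%N.
Proof.
move=> kt1; pose S := [set s | (k < f s)%N].
have lb0 : lbound S 0.
  by move=> x; rewrite /S/= leNgt => kx; apply/negP => /ltW/f_nd; rewrite f0;
    case: (f x) kx.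
have hinf : has_inf S by split; [exists t1|exists 0].
apply/idP/idP => [taus|ks]; last by apply: ge_inf => //; exists 0.
apply: leq_trans (f_nd taus); rewrite -/S.
have [e /= e0 he] := f_rc (jump_time f k).
have [x Sx xe] := @inf_adherent R S e e0 hinf.
have taux : jump_time f k <= x by apply: ge_inf => //; exists 0.
move: taux; rewrite le_eqVlt => /predU1P[->//|taux].
rewrite -(he x)//= /ball/= ltr0_norm ?subr_lt0// opprB ltrBlDl.
exact: xe.
Qed.

Lemma jump_time_ge0 (t1 : R) (k : nat) : (k < f t1)%N -> 0 <= jump_time f k.
Proof.
move=> kt1; rewrite leNgt; apply/negP => /ltW.
by rewrite (le_jump_time _ kt1) f0.
Qed.

Lemma count_jump_times (t1 s : R) : s <= t1 ->
  f s = (\sum_(k < f t1) (jump_time f k <= s)%R)%N.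
Proof.
move=> st1; rewrite (eq_bigr (fun k : 'I_(f t1) => (k < f s)%N : nat)); last first.
  by move=> k _; rewrite (le_jump_time _ (ltn_ord k)).
have : (f s <= f t1)%N by exact: f_nd.
elim: (f t1) (f s) => [|K IH] n; first by rewrite leqn0 big_ord0 => /eqP.
rewrite big_ord_recr/= leq_eqVlt => /predU1P[->|nK].
  rewrite ltnSn addn1; congr S; rewrite [LHS]IH//.
  by apply: eq_bigr => i _; rewrite ltnS ltn_ord ltnW.
by rewrite -IH// [(K < n)%N]ltnNge -ltnS nK addn0.
Qed.

End counting_path.

(** The fractional integral, up to its normalization, of a unit step at [tau]. *)
Lemma integral_kernel_jump (R : realType) (p tau x : R) : 0 < p -> p < 1 ->
    0 <= tau ->
  (\int[lebesgue_measure]_(s in `[0%R, x])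
    ((x - s) `^ (1 - p - 1) * (tau <= s)%R%:R)%:E
   = ((1 - p)^-1 * Num.max (x - tau) 0 `^ (1 - p))%:E)%E.
Proof.
move=> p0 p1 tau0.
have [tx|xt] := ltP tau x.
  rewrite (max_idPl _) ?subr_ge0 ?(ltW tx)// -integral_powR_right_singular
    ?subr_gt0//.
  rewrite integral_itv_bndo_bndc; last first.
    apply/measurable_EFinP/measurable_funTS.
    apply: (@measurableT_comp _ _ _ _ _ _ (fun r : R => r `^ (1 - p - 1))).
      exact: measurable_powR.
    exact: measurable_funB.
  rewrite [LHS]integral_mkcond [RHS]integral_mkcond; apply: eq_integral => s _.
  rewrite !patchE; have [ts|st] := leP tau s.
    rewrite mulr1; congr (if _ then _ else _).
    by apply/idP/idP; rewrite !inE/= !in_itv/= ts (le_trans tau0).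
  by rewrite mulr0; case: ifP => _; case: ifPn => //;
    rewrite inE/= in_itv/= leNgt st.
rewrite (max_idPr _) ?subr_le0// powR0 ?gt_eqF ?subr_gt0// mulr0.
apply: integral0_eq => s; rewrite /= in_itv/= => /andP[s0 sx].
have [ts|//] := leP tau s; last by rewrite mulr0.
have -> : s = x by apply/eqP; rewrite eq_le sx (le_trans xt).
rewrite subrr powR0 ?mul0r// (_ : 1 - p - 1 = - p); last by ring.
by rewrite oppr_eq0 gt_eqF.
Qed.

Lemma is_derive_kernel_jump (R : realType) (p tau t : R) : 0 < p -> p < 1 ->
    tau != t ->
  is_derive t 1 (fun x => (1 - p)^-1 * Num.max (x - tau) 0 `^ (1 - p))
    ((t - tau) `^ (- p) * (tau < t)%R%:R).
Proof.
move=> p0 p1; rewrite neq_lt => /orP[taut|ttau].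
  have tt0 : 0 < t - tau by rewrite subr_gt0.
  apply: (@near_eq_is_derive _ _ _ (fun x => (1 - p)^-1 * (x - tau) `^
    (1 - p))) => //.
    by near=> x; rewrite (max_idPl _)// subr_ge0; near: x; exact: lt_le_nbhsr.
  rewrite taut mulr1.
  have dB : is_derive t 1 (fun s : R => s - tau) (1 - 0).
    exact: (@is_deriveB _ _ _ id (cst tau)).
  have := @is_derive1_comp R (fun r : R => r `^ (1 - p)) (fun s : R => s - tau) t
      _ _
    (is_derive1_powR (1 - p) tt0) dB.
  move=> /(is_deriveZ (1 - p)^-1); rewrite subr0 mulr1 /GRing.scale/= mulKf;
    last first.
    by rewrite gt_eqF// subr_gt0.
  by rewrite (_ : 1 - p - 1 = - p)//; ring.
rewrite ltNge (ltW ttau) mulr0.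
apply: (@near_eq_is_derive _ _ _ (cst 0)) => //.
near=> x; rewrite (max_idPr _) ?powR0 ?mulr0 ?gt_eqF ?subr_gt0//.
by rewrite subr_le0; near: x; exact: lt_le_nbhsl.
Unshelve. all: by end_near. Qed.

Lemma frac_integral_counting_path (R : realType) (p t1 x : R) (f : R -> nat) :
  0 < p -> p < 1 -> counting_path f -> x <= t1 ->
  frac_integral (1 - p) (fun s => (f s)%:R) x = (gamma (1 - p))^-1 *
    \sum_(k < f t1) (1 - p)^-1 * Num.max (x - jump_time f k) 0 `^ (1 - p).
Proof.
move=> p0 p1 hf xt1; rewrite /frac_integral /Rintegral; congr (_ * _).
have mker k : measurable_fun [set: R]
    (fun s : R => (x - s) `^ (1 - p - 1) * (jump_time f k <= s)%R%:R).
  apply: measurable_funM.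
    apply: (@measurableT_comp _ _ _ _ _ _ (fun r : R => r `^ (1 - p - 1))).
      exact: measurable_powR.
    exact: measurable_funB.
  by apply: measurableT_comp => //; exact: measurable_fun_ler.
transitivity (fine (\sum_(k < f t1) \int[lebesgue_measure]_(s in `[0%R, x])
    ((x - s) `^ (1 - p - 1) * (jump_time f k <= s)%R%:R)%:E)%E).
  rewrite -ge0_integral_sum; [|by []|by move=> k;
    apply/measurable_EFinP/measurable_funTS; apply: mker|
    by move=> k s _; rewrite lee_fin mulr_ge0 ?powR_ge0].
  congr fine; apply: eq_integral => s; rewrite inE/= in_itv/= => /andP[s0 sx].
  rewrite sumEFin; congr EFin; rewrite -mulr_sumr
    (count_jump_times hf (le_trans sx xt1)).
  by rewrite natr_sum.
rewrite (eq_bigr (fun k : 'I_(f t1) =>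
    ((1 - p)^-1 * Num.max (x - jump_time f k) 0 `^ (1 - p))%:E)); last first.
  by move=> k _; apply: integral_kernel_jump => //;
    exact: (jump_time_ge0 hf (ltn_ord k)).
by rewrite sumEFin.
Qed.

Lemma is_derive_frac_integral_counting_path (R : realType) (p t t1 : R)
    (f : R -> nat) :
  0 < p -> p < 1 -> counting_path f -> t < t1 ->
  (forall k : 'I_(f t1), jump_time f k != t) ->
  is_derive t 1 (fun x => frac_integral (1 - p) (fun s => (f s)%:R) x)
    ((gamma (1 - p))^-1 *
     \sum_(k < f t1) (t - jump_time f k) `^ (- p) * (jump_time f k < t)%R%:R).
Proof.
move=> p0 p1 hf tt1 taut.
have := is_deriveZ (gamma (1 - p))^-1 (is_derive_sum
    (fun k => is_derive_kernel_jump p0 p1 (taut k))).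
apply: near_eq_is_derive; near=> x.
rewrite (frac_integral_counting_path p0 p1 hf (t1 := t1)) /GRing.scale/=.
  by rewrite fct_sumE.
by near: x; exact: lt_le_nbhsl.
Unshelve. all: by end_near. Qed.

(** Each step contributes a nondecreasing function of the time, and the one at [t]
    contributes a multiple of [h^(1 - p)] to the increment over [[t, t + h]]; the
    difference quotient is therefore at least a constant times [h^(- p)]. *)
Lemma frac_integral_jump_not_derivable (R : realType) (p t t1 : R) (f : R -> nat)
    (k : nat) :
  0 < p -> p < 1 -> counting_path f -> t < t1 -> (k < f t1)%N ->
    jump_time f k = t ->
  ~ derivable (fun x => frac_integral (1 - p) (fun s => (f s)%:R) x) t 1.
Proof.
move=> p0 p1 hf tt1 kt1 tauk dF.
set F := (fun x => _) in dF.
have G0 := gamma_gt0 p0 p1.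
have q0 : 0 < 1 - p by rewrite subr_gt0.
pose h n : R := (n.+2%:R)^-1.
have h_gt0 n : 0 < h n by rewrite invr_gt0 ltr0n.
have h0 : h n @[n --> \oo] --> 0.
  have := @cvg_harmonic R; rewrite -cvg_shiftS; exact.
(* Otherwise the quotients along h_n = 1 / (n + 2) converge, and multiplied by
   h_n ^ p they tend to 0, against the lower bound c. *)
have [l Fl] : exists l : R, (h n)^-1 *: (F (h n + t) - F t) @[n --> \oo] --> l.
  exists (lim (r^-1 *: (F (r *: 1 + t) - F t) @[r --> 0^'])).
  rewrite (_ : (fun n => _) = (fun r => r^-1 *: (F (r *: 1 + t) - F t)) \o h);
    last first.
    by apply/funext => n; rewrite /= /GRing.scale/= mulr1.
  apply: (@cvg_comp _ _ _ h _ \oo (0^') _ _ dF).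
  move=> U [e /= e0 eU].
  have : \forall n \near \oo, ball 0 e (h n) by move/cvg_ball: h0; exact.
  by apply: filterS => n hn; apply: eU => //; rewrite gt_eqF.
have /(cvgM Fl) : (h n) `^ p @[n --> \oo] --> (0 : R) by exact: cvg_harmonic_powR.
rewrite mulr0 => FH.
pose c := (gamma (1 - p))^-1 * (1 - p)^-1.
have c0 : 0 < c by rewrite mulr_gt0// invr_gt0.
have lower n : h n + t <= t1 -> c <= (h n)^-1 *: (F (h n + t) - F t) * h n `^ p.
  move=> ht1; rewrite /F !(frac_integral_counting_path p0 p1 hf (t1 := t1))//;
    last exact/ltW.
  rewrite -mulrBr -sumrB /GRing.scale/=.
  have -> : c = (h n)^-1 * (c * h n `^ (1 - p)) * h n `^ p.
    rewrite -mulrA -[c * _ * _]mulrA -powRD;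
      last by rewrite (gt_eqF (h_gt0 n)) implybT.
    by rewrite subrK powRr1 ?ltW// mulrC mulfK// gt_eqF.
  rewrite ler_wpM2r ?powR_ge0// ler_wpM2l ?invr_ge0 ?(ltW (h_gt0 n))//.
  rewrite -mulrA ler_wpM2l ?invr_ge0 ?(ltW G0)//.
  rewrite (bigD1 (Ordinal kt1))//= tauk addrK subrr.
  rewrite (max_idPl _) ?(ltW (h_gt0 n))// (max_idPl _)// powR0 ?gt_eqF// mulr0
    subr0.
  rewrite lerDl sumr_ge0// => j _; rewrite -mulrBr mulr_ge0 ?invr_ge0 ?(ltW q0)//.
  rewrite subr_ge0; apply: ge0_ler_powR; rewrite ?nnegrE ?(ltW q0)//.
  - by rewrite le_max lexx orbT.
  - by rewrite le_max lexx orbT.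
  - by rewrite ge_max !le_max lexx orbT andbT lerB// lerDr ltW.
have near1 := cvgr_lt _ FH _ c0.
have near2 : \forall n \near \oo, h n < t1 - t by apply: (cvgr_lt _ h0);
    rewrite subr_gt0.
near \oo => n.
have : h n + t <= t1 by rewrite -lerBrDr ltW//; near: n.
by move/lower; rewrite leNgt => /negP; apply; near: n; exact: near1.
Unshelve. all: by end_near. Qed.

(** * The derivative as an integral of increments *)

(** The fractional derivative of order [p] at [t], up to a constant factor,
    computed from increments of the path; the rescaling of the window by [b]
    makes the Gompertz expectation an integral with no parameter other than
    [b * t]. The value is extended-real since it is infinite when the path jumps
    at [t]. *)
Definition weighted_increments (R : realType) (p b t : R) (f : R -> nat) : \bar R :=
  (\int[lebesgue_measure]_(r in `]0%R, +oo[)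
     (p * r `^ (- p - 1) * (f t - f (t - r / b)%R)%N%:R)%:E)%E.

Section weighted_increments.
Variables (R : realType) (p b t : R) (f : R -> nat).
Hypotheses (p0 : 0 < p) (b0 : 0 < b) (f_path : counting_path f).

(** The increment over [(t - r / b, t]] counts the jump times in that window. *)
Lemma weighted_increments_sum (t1 : R) : t <= t1 ->
  weighted_increments p b t f = (\sum_(k < f t1)
    \int[lebesgue_measure]_(r in `]0%R, +oo[)
     (p * r `^ (- p - 1) *
       ((jump_time f k <= t)%R && (t - r / b < jump_time f k)%R)%:R)%:E)%E.
Proof.
move=> tt1; rewrite -ge0_integral_sum; [|by []| |]; first last.
- by move=> k r _; rewrite lee_fin !mulr_ge0 ?powR_ge0// ltW.
- move=> k; apply/measurable_EFinP/measurable_funTS; apply: measurable_funM.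
    by apply: measurable_funM => //; exact: measurable_powR.
  apply: measurableT_comp => //; apply: measurable_and => //.
  apply: measurable_fun_ltr => //; apply: measurable_funB => //.
  exact: measurable_funM.
apply: eq_integral => r; rewrite inE/= in_itv/= andbT => r0.
rewrite sumEFin -mulr_sumr; congr (_ * _)%:E.
have rb : t - r / b <= t by rewrite gerBl divr_ge0// ltW.
rewrite [f t](count_jump_times f_path tt1)
  (count_jump_times f_path (le_trans rb tt1)).
rewrite -sumnB; last first.
  move=> k _; case: (leP (jump_time f k) (t - r / b)) => // h.
  by rewrite (le_trans h rb).
rewrite natr_sum; apply: eq_bigr => k _; congr (_%:R).
by rewrite ltNge; case: (_ <= t); case: (_ <= _).
Qed.

Lemma weighted_increments_no_jump (t1 : R) : t <= t1 ->
  (forall k : 'I_(f t1), jump_time f k != t) ->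
  weighted_increments p b t f =
    (b `^ (- p) * \sum_(k < f t1) (t - jump_time f k) `^
      (- p) * (jump_time f k < t)%R%:R)%:E.
Proof.
move=> tt1 tau_neq; rewrite (weighted_increments_sum tt1) mulr_sumr -sumEFin.
apply: eq_bigr => k _; rewrite le_eqVlt (negbTE (tau_neq k))/=.
have [taut|_] := ltP (jump_time f k) t; last first.
  by rewrite !mulr0; apply: integral0_eq => r _; rewrite mulr0.
have u0 : 0 < t - jump_time f k by rewrite subr_gt0.
rewrite mulr1 -powRM ?(ltW b0) ?(ltW u0)// -powR_layer_cake ?mulr_gt0//.
apply: eq_integral => r _; congr (_ * _%:R)%:E => /=.
by rewrite ltrBlDr -ltrBlDl ltr_pdivlMr// mulrC.
Qed.

Lemma weighted_increments_jump (t1 : R) (k : nat) : t <= t1 -> (k < f t1)%N ->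
  jump_time f k = t -> weighted_increments p b t f = +oo%E.
Proof.
move=> tt1 kt1 tauk; rewrite (weighted_increments_sum tt1) (bigD1 (Ordinal kt1))//=.
rewrite [X in (X + _)%E](_ : _ = +oo%E); last first.
  rewrite -(powR_layer_cake0 p0); apply: eq_integral => r;
    rewrite inE/= in_itv/= andbT => r0.
  by rewrite tauk lexx ltrBlDr ltrDl divr_gt0// mulr1.
rewrite addye// gt_eqF// (@lt_le_trans _ _ 0%E)//.
apply: sume_ge0 => j _; apply: integral_ge0 => r _.
by rewrite lee_fin !mulr_ge0 ?powR_ge0// ltW.
Qed.

End weighted_increments.

(** The weighted increments decide alone whether the derivative exists, and give
    its value; no reference to the jump times remains, so that measurability and
    integrability can be read off. *)
Lemma derive1_frac_integral_counting_path (R : realType) (p b t : R)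
    (f : R -> nat) :
  0 < p -> p < 1 -> 0 < b -> counting_path f ->
  (forall c, weighted_increments p b t f = c%:E ->
    is_derive t 1 (fun x => frac_integral (1 - p) (fun s => (f s)%:R) x)
      ((gamma (1 - p))^-1 * (b `^ p * c))) /\
  (weighted_increments p b t f = +oo%E ->
    ~ derivable (fun x => frac_integral (1 - p) (fun s => (f s)%:R) x) t 1).
Proof.
move=> p0 p1 b0 hf; have tt1 : t < t + 1 by rewrite ltrDl.
have [[k tauk]|] := pselect (exists k : 'I_(f (t + 1)), jump_time f k = t).
  rewrite (weighted_increments_jump p0 b0 hf (ltW tt1) (ltn_ord k) tauk).
  by split=> // _; exact: (frac_integral_jump_not_derivable p0 p1 hf tt1
    (ltn_ord k) tauk).
move=> /forallNP tau_neq.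
have {}tau_neq (k : 'I_(f (t + 1))) : jump_time f k != t by apply/eqP/tau_neq.
rewrite (weighted_increments_no_jump p0 b0 hf (ltW tt1) tau_neq).
split=> // _ [<-]; rewrite mulrA -powRD; last by rewrite (gt_eqF b0) implybT.
by rewrite subrr powRr0 mul1r; exact: is_derive_frac_integral_counting_path.
Qed.

(** * The Poisson process with Gompertz clock *)

Lemma gompertz0 (R : realType) (a b : R) : gompertz a b 0 = 0.
Proof. by rewrite /gompertz mulr0 expR0 subrr mulr0. Qed.

Lemma le_gompertz (R : realType) (a b s t : R) : 0 < a -> 0 < b -> s <= t ->
  gompertz a b s <= gompertz a b t.
Proof.
move=> a0 b0 st; rewrite /gompertz; apply: ler_wpM2l;
  first by rewrite divr_ge0 ?ltW.
by rewrite lerD2r ler_expR ler_wpM2l// ltW.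
Qed.

Lemma gompertz_ge0 (R : realType) (a b s : R) : 0 < a -> 0 < b -> 0 <= s ->
  0 <= gompertz a b s.
Proof. by move=> a0 b0 s0; rewrite -(gompertz0 a b) le_gompertz. Qed.

Lemma continuous_gompertz (R : realType) (a b : R) : continuous (@gompertz R a b).
Proof.
move=> s; apply: cvgM; first exact: cvg_cst.
apply: cvgB; last exact: cvg_cst.
apply: (@continuous_comp _ _ _ (fun s : R => b * s) expR);
  last exact: continuous_expR.
by apply: cvgM; [exact: cvg_cst|exact: cvg_id].
Qed.

Section gompertz_poisson.
Variables (d : measure_display) (T : measurableType d) (R : realType).
Variables (P : probability T R) (N : R -> T -> nat) (a b : R).
Hypothesis hN : standard_poisson_process P N.
Hypotheses (a0 : 0 < a) (b0 : 0 < b).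

(** Truncating the time at [0] prolongs the process by [0] to negative times, and
    changes nothing in the fractional integral, which only sees [[0, x]]. *)
Definition gompertz_count (s : R) (w : T) : nat := N (gompertz a b (Num.max s 0)) w.

Let clock_ge0 (s : R) : 0 <= gompertz a b (Num.max s 0).
Proof. by rewrite gompertz_ge0// le_max lexx orbT. Qed.

Let le_clock (s t : R) : s <= t -> gompertz a b (Num.max s 0) <= gompertz a b
    (Num.max t 0).
Proof. by move=> st; rewrite le_gompertz// ge_max !le_max st lexx orbT. Qed.

Lemma gompertz_count_path (w : T) : counting_path (gompertz_count ^~ w).
Proof.
split=> [s t st|t|].
- by apply: (poisson_nondecreasing hN) => //; exact: le_clock.
- pose g (s : R) := gompertz a b (Num.max s 0).
  have [e /= e0 he] := cvg_natr_near_eq (@poisson_right_continuous _ _ _ _ _ hN w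
      _ (clock_ge0 t)).
  have gc : {for t, continuous g}.
    apply: (@continuous_comp _ _ _ (fun s : R => Num.max s 0) (gompertz a b));
      last exact: continuous_gompertz.
    by apply: continuous_max; [exact: cvg_id|exact: cvg_cst].
  have ge : \forall s \near t^'+, `|g t - g s| < e.
    by have /cvgrPdist_lt/(_ e e0) := cvg_at_right_filter gc.
  (* The clock may stand still just after t; otherwise it moves slightly above
     its value at t, where the path of N is constant. *)
  near=> s.
  have ts : g t <= g s by apply: le_clock; near: s; exact: nbhs_right_ge.
  move: ts; rewrite le_eqVlt => /predU1P[tse|ts].
    by rewrite /gompertz_count -/(g s) -tse.
  by apply: he => //; rewrite /ball/=; near: s.
- by rewrite /gompertz_count maxxx gompertz0 (poisson_start hN).
Unshelve. all: by end_near. Qed.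

Lemma measurable_gompertz_count :
  measurable_fun [set: T * R] (fun z : T * R => gompertz_count z.2 z.1).
Proof.
apply: measurable_right_continuous_process.
- by move=> s; apply: (poisson_measurable hN).
- by move=> w; exact: (counting_path_nd (gompertz_count_path w)).
- by move=> w; exact: (counting_path_rc (gompertz_count_path w)).
Qed.

Lemma gompertz_count_mean (s t : R) : s <= t ->
  (\int[P]_w ((gompertz_count t w - gompertz_count s w)%N%:R)%:E =
   (gompertz a b (Num.max t 0) - gompertz a b (Num.max s 0))%:E)%E.
Proof. by move=> st; apply: (poisson_increment_mean hN) => //; exact: le_clock. Qed.

Lemma measurable_weighted_gompertz_increment (p t : R) :
  measurable_fun [set: T * R] (fun z : T * R =>
    (p * z.2 `^ (- p - 1) * (gompertz_count t z.1 - gompertz_count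
      (t - z.2 / b)%R z.1)%N%:R)%:E).
Proof.
apply/measurable_EFinP; apply: measurable_funM.
  apply: measurable_funM => //.
  exact: (measurableT_comp (@measurable_powR R (- p - 1)) measurable_snd).
apply: measurable_natr_comp; apply: measurable_increment.
  have mpair : measurable_fun [set: T * R] (fun z : T * R => (z.1, t - z.2 / b)).
    apply: measurable_fun_pair => //; apply: measurable_funB => //.
    exact: measurable_funM.
  exact: (measurableT_comp measurable_gompertz_count mpair).
have mpair : measurable_fun [set: T * R] (fun z : T * R => (z.1, t)).
  exact: measurable_fun_pair.
exact: (measurableT_comp measurable_gompertz_count mpair).
Qed.

Lemma expectation_weighted_increments (p t : R) : 0 < p -> p < 1 -> 0 < t ->
  (\int[P]_w weighted_increments p b t (gompertz_count ^~ w) =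
   (a / b * (expR (b * t) * gamma (1 - p)
     + p * expR (b * t) * upper_incomplete_gamma (- p) (b * t)
     - (b * t) `^ (- p)))%:E)%E.
Proof.
move=> p0 p1 t0.
have ge0 r n : (0 <= (p * r `^ (- p - 1) * n%:R)%:E)%E :> bool.
  by rewrite lee_fin !mulr_ge0 ?powR_ge0// ltW.
rewrite /weighted_increments.
have := @tonelli_setX _ _ T (measurableTypeR R) R P (@lebesgue_measure R) setT
  `]0, +oo[%classic _ measurableT (measurable_itv _)
  (measurable_weighted_gompertz_increment p t).
move=> /= ->; last by [].
have ab0 : 0 <= a / b by rewrite divr_ge0// ltW.
rewrite (EFinM (a / b)) -integral_compensated_exp ?mulr_gt0//.
rewrite -ge0_integralZl; [|by []| | |by rewrite lee_fin].
- apply: eq_integral => r; rewrite inE/= in_itv/= andbT => r0.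
  under eq_integral do rewrite EFinM.
  rewrite ge0_integralZl; [|by []| |by move=> w _; rewrite lee_fin|]; last 2 first.
  + apply/measurable_EFinP/measurable_natr_comp/measurable_increment.
      by apply: (poisson_measurable hN).
    by apply: (poisson_measurable hN).
  + by rewrite lee_fin mulr_ge0 ?powR_ge0// ltW.
  rewrite gompertz_count_mean; last by rewrite gerBl divr_ge0// ltW.
  rewrite -!EFinM mulrCA; congr (_ * _)%:E.
  rewrite /gompertz (max_idPl (ltW t0)) -mulrBr; congr (_ * _).
  rewrite opprB addrA subrK; congr (_ - expR _).
  rewrite maxr_pMr ?(ltW b0)// mulr0 mulrBr; congr (Num.max (_ - _) _).
  by rewrite mulrCA mulfV ?gt_eqF// mulr1.
- apply/measurable_EFinP/measurable_funTS; apply: measurable_funM.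
    by apply: measurable_funM => //; exact: measurable_powR.
  apply: measurable_funB => //; apply: measurableT_comp => //.
  by apply: measurable_maxr => //; exact: measurable_funB.
- move=> r; rewrite /= in_itv/= andbT => r0; rewrite lee_fin mulr_ge0//.
    by rewrite mulr_ge0 ?powR_ge0// ltW.
  by rewrite subr_ge0 ler_expR ge_max mulr_ge0 ?(ltW b0) ?(ltW t0)// andbT gerBl
    ltW.
Qed.

End gompertz_poisson.

Theorem lemma3p14 (d : measure_display) (T : measurableType d) (R : realType)
    (P : probability T R) (N : R -> T -> nat) (theta a b t : R)
    (hN : standard_poisson_process P N)
    (htheta0 : 0 < theta) (htheta1 : theta < 1)
    (ha : 0 < a) (hb : 0 < b) (ht : 0 < t) :
  let Nlambda := nonhomogeneous_poisson (gompertz a b) N in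
  let NN := frac_integral_process (1 - theta) Nlambda in
  let dNN := fun w : T => derive1 (fun s : R => NN s w) t in
  [/\ {ae P, forall w, derivable (fun s : R => NN s w) t 1},
      P.-integrable [set: T] (EFin \o dNN) &
      ('E_P[dNN])%E =
      (a * b `^ (theta - 1) * expR (b * t) *
         (1 + theta / gamma (1 - theta) *
            upper_incomplete_gamma (- theta) (b * t))
       - a * t `^ (- theta) / (b * gamma (1 - theta)))%:E].
Proof.
move=> Nlambda NN dNN.
have NNE w : (fun s => NN s w) =
    (fun x => frac_integral (1 - theta) (fun s => (gompertz_count N a b s w)%:R) x).
  apply/funext => x; rewrite /NN /frac_integral_process /frac_integral;
    congr (_ * _).
  apply: eq_Rintegral => s; rewrite inE/= in_itv/= => /andP[s0 _].
  by rewrite /Nlambda /nonhomogeneous_poisson /gompertz_count (max_idPl s0).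
pose W w := weighted_increments theta b t (gompertz_count N a b ^~ w).
have dW w : (forall e, W w = e%:E ->
      is_derive t 1 (fun s => NN s w) ((gamma (1 - theta))^-1 * (b `^
        theta * e))) /\
    (W w = +oo%E -> ~ derivable (fun s => NN s w) t 1).
  rewrite NNE; apply: derive1_frac_integral_counting_path => //.
  exact: gompertz_count_path hN ha hb w.
have W0 w : (0 <= W w)%E.
  by apply: integral_ge0 => r _; rewrite lee_fin !mulr_ge0 ?powR_ge0// ltW.
have mW : measurable_fun [set: T] W.
  apply: (@measurable_integral_setX _ _ T (measurableTypeR R) R
    (@lebesgue_measure R)
    `]0, +oo[%classic _ (measurable_itv _)
    (measurable_weighted_gompertz_increment hN ha hb theta t)).
  by move=> z; rewrite lee_fin !mulr_ge0 ?powR_ge0// ltW.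
have EW := expectation_weighted_increments hN ha hb htheta0 htheta1 ht.
have G0 := gamma_gt0 htheta0 htheta1.
have iW : P.-integrable [set: T] W.
  apply/integrableP; split=> //.
  under eq_integral do rewrite gee0_abs//.
  by rewrite EW ltry.
pose c := (gamma (1 - theta))^-1 * b `^ theta.
(* At a jump the difference quotients diverge and their limit takes the same
   default value for all paths, so the derivative stays measurable. *)
have dNNE : EFin \o dNN = (fun w => if W w == +oo%E then (point : R)%:E else
    c%:E * W w)%E.
  apply/funext => w; rewrite /= /dNN derive1E.
  case: (W w) (W0 w) (dW w) => [e _ [/(_ _ erefl) he _]|_ [_ /(_ erefl) he]|//].
    by rewrite derive_val/= -EFinM mulrA.
  by rewrite /derive dvgP.
(* Finite expectation alone excludes a jump at t, almost surely. *)
have aeW : {ae P, forall w, W w \is a fin_num}.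
  by apply: filterS (integrable_ae measurableT iW) => w /(_ I).
have mdNN : measurable_fun [set: T] (EFin \o dNN).
  rewrite dNNE; apply: measurable_fun_ifT => //.
    exact: measurable_fun_eqe.
  exact: measurable_funeM.
have mcW : measurable_fun [set: T] (fun w => c%:E * W w)%E.
  exact: measurable_funeM.
have aedNN : ae_eq P setT (EFin \o dNN) (fun w => c%:E * W w)%E.
  by apply: filterS aeW => w; rewrite fin_numE dNNE => /andP[_ /negbTE ->].
have icW : P.-integrable [set: T] (fun w => c%:E * W w)%E by exact: integrableZl.
split.
- apply: filterS aeW => w; case: (W w) (dW w) => [e [/(_ _ erefl)[]]| |] //.
- apply/integrableP; split=> //.
  rewrite (ae_eq_integral (fun w => `|c%:E * W w|)%E) => //.
  + by have /integrableP[] := icW.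
  + exact: measurableT_comp.
  + exact: measurableT_comp.
  + by apply: filterS aedNN => w h wT; congr abse; exact: h.
rewrite unlock (ae_eq_integral (fun w => c%:E * W w)%E)//.
rewrite integralZl//= EW -EFinM; congr EFin.
rewrite /c powRM ?(ltW hb) ?(ltW ht)//.
rewrite [b `^ (- theta)]powRN powRD ?(gt_eqF hb) ?implybT// powR_inv1 ?(ltW hb)//.
have bt0 : 0 < b `^ theta by exact: powR_gt0.
field.
by rewrite !gt_eqF.
Qed.
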